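(* Let $\pi:E\to[n]$ be a surjection from a finite set $E$ with $|\pi^{-1}(i)|\ge2$ for every $i$, and let $\mathbf E=(E_1,\dots,E_n)$ with $E_i=\pi^{-1}(i)$. The pointed fan ${}^{\wedge}\Sigma_\pi$ is a subfan of ${}^{\wedge}\Psi(\mathbf E)$. Consequently, $\widetilde\Sigma_\pi$ is a subfan of $\Psi(\mathbf E)$, and the $\pi$-colored fan $\Sigma_\pi$ is a subfan of $\Psi(\mathbf E)/\mathsf L(\mathbf E)$.
   Context: For $T\subseteq E$ write $e_T=\sum_{s\in T}e_s\in\mathbb R^E$. Let $\mathsf L(\mathbf E)=\operatorname{Span}\{e_{E_1},\dots,e_{E_n}\}$. $\pi$-colored fans. A set $S\subseteq E$ is $\pi$-colored if $|S\cap E_i|\le1$ for every $i$. ${}^{\wedge}\Sigma_\pi$ consists of the cones $\operatorname{Cone}(e_{S_1},\dots,e_{S_k})$ over all (possibly empty) chains $S_1\subsetneq\dots\subsetneq S_k$ of nonempty $\pi$-colored sets. $\widetilde\Sigma_\pi={}^{\wedge}\Sigma_\pi+\mathsf L(\mathbf E)$ (add $\mathsf L(\mathbf E)$ to every cone) and $\Sigma_\pi=\widetilde\Sigma_\pi/\mathsf L(\mathbf E)$ (the image in $\mathbb R^E/\mathsf L(\mathbf E)$). The fan $\Psi(\mathbf E)$. A tuple $\mathbf A=(A_1,\dots,A_n)$ is valid if $\emptyset\ne A_i\subseteq E_i$ for all $i$; put $u_{\mathbf A}=\sum_{s\in E\setminus\bigcup_iA_i}e_s$. ${}^{\wedge}\Psi(\mathbf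 E)$ is the fan of cones $\operatorname{Cone}(u_{\mathbf A_1},\dots,u_{\mathbf A_m})$ over all (possibly empty) chains $\mathbf A_1\subsetneq\dots\subsetneq\mathbf A_m$ of valid tuples different from $\mathbf E$ (ordered componentwise by inclusion), and $\Psi(\mathbf E)={}^{\wedge}\Psi(\mathbf E)+\mathsf L(\mathbf E)$; the latter is the barycentric subdivision of the normal fan of the product of standard simplices $\prod_i\operatorname{conv}\{e_s:s\in E_i\}\subset\mathbb R^E$. *)

(* Defs.v *)
From HB Require Import structures.
From mathcomp Require Import all_boot all_order all_algebra.
From mathcomp Require Import generic_quotient ring_quotient.
From mathcomp Require Import boolp classical_sets cardinality reals.

Set Implicit Arguments.
Unset Strict Implicit.
Unset Printing Implicit Defensive.

Import Order.TTheory GRing.Theory Num.Theory.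

Local Open Scope classical_set_scope.
Local Open Scope ring_scope.

Section VectorQuotient.
Local Open Scope quotient_scope.
Variables (K : fieldType) (V : vectType K) (L : {vspace V}).

(* The Z-module quotient by the additive subgroup L comes from
   ring_quotient; only the scalar multiplication has to be added. *)
Definition vquot : Type := (Quotient.quot (pred_of_vspace L)).

HB.instance Definition _ := GRing.Zmodule.on vquot.

Definition vquot_proj (x : V) : vquot := \pi_((Quotient.quot (pred_of_vspace L))) x.

Definition vquot_scale (a : K) (x : vquot) : vquot :=
  vquot_proj (a *: repr (x : (Quotient.quot (pred_of_vspace L)))).

Lemma vquot_projP (x y : V) : reflect (vquot_proj x = vquot_proj y) (x - y \in L).
Proof.
have /= := @Quotient.idealrBE V (pred_of_vspace L) x y.
move=> ->; exact: eqP.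
Qed.

Lemma vquot_proj_repr (x : vquot) : vquot_proj (repr (x : (Quotient.quot (pred_of_vspace L)))) = x.
Proof. exact: reprK. Qed.

Lemma vquot_projD (x y : V) : vquot_proj (x + y) = vquot_proj x + vquot_proj y.
Proof. exact: (raddfD (\pi_((Quotient.quot (pred_of_vspace L))))). Qed.

Lemma vquot_scaleE (a : K) (x : V) :
  vquot_scale a (vquot_proj x) = vquot_proj (a *: x).
Proof.
apply/vquot_projP; rewrite -scalerBr memvZ //.
by apply/vquot_projP; rewrite vquot_proj_repr.
Qed.

Lemma vquot_scaleA (a b : K) (x : vquot) :
  vquot_scale a (vquot_scale b x) = vquot_scale (a * b) x.
Proof. by rewrite -(vquot_proj_repr x) !vquot_scaleE scalerA. Qed.

Lemma vquot_scale1 : left_id 1 vquot_scale.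
Proof. by move=> x; rewrite -(vquot_proj_repr x) vquot_scaleE scale1r. Qed.

Lemma vquot_scaleDr : right_distributive vquot_scale +%R.
Proof.
move=> a x y; rewrite -(vquot_proj_repr x) -(vquot_proj_repr y).
by rewrite -vquot_projD !vquot_scaleE scalerDr vquot_projD.
Qed.

Lemma vquot_scaleDl (x : vquot) : {morph vquot_scale^~ x : a b / a + b}.
Proof.
move=> a b; rewrite -(vquot_proj_repr x) !vquot_scaleE.
by rewrite scalerDl vquot_projD.
Qed.

HB.instance Definition _ := GRing.Zmodule_isLmodule.Build K vquot
  vquot_scaleA vquot_scale1 vquot_scaleDr vquot_scaleDl.

Lemma vquot_proj_is_linear : linear vquot_proj.
Proof. by move=> a x y; rewrite vquot_projD -vquot_scaleE. Qed.

HB.instance Definition _ := GRing.isLinear.Build K V vquot _ vquot_proj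
  vquot_proj_is_linear.

End VectorQuotient.

Section Fans.
Variables (R : numFieldType) (V : lmodType R).
Implicit Types (C D : set V) (F G : set (set V)).

Definition cone (s : seq V) : set V :=
  [set v | exists2 a : nat -> R, forall i, 0 <= a i
                               & v = \sum_(i < size s) a i *: s`_i].

Definition polyhedral_cone C : Prop := exists s : seq V, C = cone s.

Definition is_face D C : Prop :=
  exists2 f : {scalar V}, forall x, C x -> 0 <= f x
                        & D = C `&` [set x | f x = 0].

(* Cones are allowed to have a nontrivial lineality space. *)
Definition is_fan F : Prop :=
  [/\ finite_set F, F !=set0,
      forall C, F C -> polyhedral_cone C,
      forall C D, F C -> is_face D C -> F D
    & forall C D, F C -> F D -> is_face (C `&` D) C /\ is_face (C `&` D) D].

Definition pointed_fan F : Prop :=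
  is_fan F /\ forall C x, F C -> C x -> C (- x) -> x = 0.

Definition subfan F G : Prop := [/\ is_fan F, is_fan G & F `<=` G].

End Fans.

Section LinealityAndQuotient.
Variables (R : numFieldType) (V : vectType R).
Implicit Types (F : set (set V)) (L : {vspace V}).

Definition fan_add F L : set (set V) :=
  [set [set z | exists x y, [/\ C x, y \in L & z = x + y]] | C in F].

Definition fan_quot F L : set (set (vquot L)) :=
  [set [set vquot_proj L x | x in C] | C in F].

End LinealityAndQuotient.

Arguments fan_add {R V} F L.
Arguments fan_quot {R V} F L.

Section ColoredFans.
Variables (R : realType) (E : finType) (n : nat) (pi : E -> 'I_n).

Definition evec (T : {set E}) : {ffun E -> R^o} :=
  \sum_(s in T) [ffun t => (t == s)%:R].

Definition fiber (i : 'I_n) : {set E} := [set s | pi s == i]%SET.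

Definition lineality : {vspace {ffun E -> R^o}} :=
  <<[seq evec (fiber i) | i : 'I_n]>>%VS.

Definition colored (T : {set E}) : bool := [forall i, #|T :&: fiber i| <= 1]%N.

(* The relation \proper is transitive, so a sorted sequence is a chain. *)
Definition hat_Sigma : set (set {ffun E -> R^o}) :=
  [set C | exists s : seq {set E},
     [/\ sorted (fun T T' : {set E} => T \proper T') s,
         all (fun T : {set E} => (T != finset.set0) && colored T) s
       & C = cone [seq evec T | T <- s]]].

Definition tilde_Sigma : set (set {ffun E -> R^o}) := fan_add hat_Sigma lineality.

Definition Sigma : set (set (vquot lineality)) := fan_quot tilde_Sigma lineality.

Implicit Types A B : {ffun 'I_n -> {set E}}.

Definition Etuple : {ffun 'I_n -> {set E}} := [ffun i => fiber i].

Definition valid A : bool :=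
  [forall i, (A i != finset.set0) && (A i \subset fiber i)].

Definition tuple_proper A B : bool := [forall i, A i \subset B i] && (A != B).

Definition uvec A : {ffun E -> R^o} := evec (~: \bigcup_i A i)%SET.

Definition hat_Psi : set (set {ffun E -> R^o}) :=
  [set C | exists s : seq {ffun 'I_n -> {set E}},
     [/\ sorted tuple_proper s,
         all (fun A => valid A && (A != Etuple)) s
       & C = cone [seq uvec A | A <- s]]].

Definition Psi : set (set {ffun E -> R^o}) := fan_add hat_Psi lineality.

Definition Psi_quot : set (set (vquot lineality)) := fan_quot Psi lineality.

End ColoredFans.

Arguments hat_Sigma R {E n} pi.
Arguments tilde_Sigma R {E n} pi.
Arguments Sigma R {E n} pi.
Arguments hat_Psi R {E n} pi.
Arguments Psi R {E n} pi.
Arguments Psi_quot R {E n} pi.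

(* Main.v *)
Require Import Defs.
From HB Require Import structures.
From mathcomp Require Import all_boot all_order all_algebra.
From mathcomp Require Import boolp classical_sets cardinality reals.

Set Implicit Arguments.
Unset Strict Implicit.
Unset Printing Implicit Defensive.
Import Order.TTheory GRing.Theory Num.Theory.
Local Open Scope classical_set_scope.
Local Open Scope ring_scope.

(** All the fans involved are of one kind. For a predicate P on subsets of E, let
    F(P) consist of the cones spanned by the indicator vectors of chains of
    nonempty sets satisfying P. Then F of the colored sets is the pointed colored
    fan by definition, and F of the sets containing no fiber is the fan of valid
    tuples: complements in the fibers turn a valid tuple into such a set, reversing
    inclusions ([hat_PsiE]). As every fiber has at least two points, a colored set
    contains no fiber, so one family of cones is included in the other, and it
    remains to see that each family is a fan.

    F(P) is a simplicial fan for every P ([chain_fan_is_fan]). If v is a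
    nonnegative combination of a chain, the sets with positive coefficient are
    exactly the superlevel sets of v at positive levels ([chain_superlevel],
    [superlevel_chain]), so they depend on v only. Hence the cones of two chains
    meet in the cone of the common subchain, and, comparing the positive and the
    negative part of a linear relation, the generators of a chain are linearly
    independent, so that every subchain spans a face.

    For the sets containing no fiber, the largest set of a chain misses a point of
    each fiber, so a vector in the support has minimum 0 on every fiber, whereas
    vectors of the lineality space are constant on fibers. Thus the support meets
    every coset of the lineality space at most once ([chain_fan_lineality]), and
    this is enough for the sums with that space to form a fan ([is_fan_add]). A fan
    whose cones are stable under translation by a subspace descends to the quotient
    ([is_fan_quot]). *)

(** * Finitely generated cones *)

Section Cones.
Variables (R : numFieldType) (V : lmodType R).
Implicit Types (s t : seq V) (x y : V).

Lemma cone0 s : cone s 0.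
Proof.
exists (fun=> 0) => //; rewrite big1 // => i _; exact: scale0r.
Qed.

Lemma coneD s x y : cone s x -> cone s y -> cone s (x + y).
Proof.
move=> [a a0 ->] [b b0 ->]; exists (fun i => a i + b i) => [i|].
  exact: addr_ge0.
by rewrite -big_split; apply: eq_bigr => i _; rewrite scalerDl.
Qed.

Lemma coneZ s k x : 0 <= k -> cone s x -> cone s (k *: x).
Proof.
move=> k0 [a a0 ->]; exists (fun i => k * a i) => [i|].
  exact: mulr_ge0.
by rewrite scaler_sumr; apply: eq_bigr => i _; rewrite scalerA.
Qed.

Lemma mem_cone s x : x \in s -> cone s x.
Proof.
move=> xs; exists (fun i => (i == index x s)%:R) => [i|]; first exact: ler0n.
have ix : (index x s < size s)%N by rewrite index_mem.
rewrite (bigD1 (Ordinal ix)) //= eqxx scale1r nth_index // big1 ?addr0 //.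
by move=> i; rewrite -val_eqE /= => /negPf ->; rewrite scale0r.
Qed.

Lemma cone_sum s (I : Type) (r : seq I) (P : pred I) (F : I -> V) :
  (forall i, P i -> cone s (F i)) -> cone s (\sum_(i <- r | P i) F i).
Proof.
by move=> sF; elim/big_ind: _ => //; [exact: cone0|exact: coneD].
Qed.

Lemma cone_sub s t : (forall x, x \in s -> cone t x) -> cone s `<=` cone t.
Proof.
move=> st x [a a0 ->]; apply: cone_sum => i _; apply: coneZ => //.
exact/st/mem_nth.
Qed.

Lemma cone_subset s t : {subset s <= t} -> cone s `<=` cone t.
Proof. by move=> st; apply: cone_sub => x /st/mem_cone. Qed.

Lemma eq_mem_cone s t : s =i t -> cone s = cone t.
Proof. by move=> st; apply/seteqP; split; apply: cone_subset => x; rewrite st. Qed.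

(** When the generators are indexed by a duplicate-free list, the coefficients
    may be taken to be a function of the index instead of the position. *)
Lemma cone_mapP (T : eqType) (f : T -> V) (c : seq T) x : uniq c ->
  cone [seq f j | j <- c] x <->
  exists2 a : T -> R, forall j, 0 <= a j & x = \sum_(j <- c) a j *: f j.
Proof.
move=> uc; split=> [[a a0 ->]|[a a0 ->]]; last first.
  rewrite big_seq; apply: cone_sum => j jc; apply: coneZ => //.
  exact/mem_cone/map_f.
exists (fun j => a (index j c)) => //; rewrite size_map.
case: c uc => [|j0 c] uc; first by rewrite big_ord0 big_nil.
rewrite (big_nth j0) big_mkord; apply: eq_bigr => i _.
by rewrite index_uniq // (nth_map j0).
Qed.

Lemma cone_ge0 (f : {scalar V}) s x :
  (forall y, y \in s -> 0 <= f y) -> cone s x -> 0 <= f x.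
Proof.
move=> f0 [a a0 ->]; rewrite linear_sum; apply: sumr_ge0 => i _.
by rewrite linearZ; apply: mulr_ge0 => //; apply/f0/mem_nth.
Qed.

(** The face of a cone cut out by f is generated by the generators that it
    contains. *)
Lemma cone_face_filter (f : {scalar V}) s : (forall y, y \in s -> 0 <= f y) ->
  cone s `&` [set x | f x = 0] = cone [seq x <- s | f x == 0].
Proof.
move=> f0; apply/seteqP; split=> x /=; last first.
  move=> sx; split.
    by apply: cone_subset sx => y; rewrite mem_filter => /andP[].
  case: sx => a _ ->; rewrite linear_sum big1 // => i _.
  rewrite linearZ /=.
  have := mem_nth 0 (ltn_ord i); rewrite mem_filter => /andP[/eqP -> _].
  exact: mulr0.
case=> [[a a0 ->]] /eqP; rewrite linear_sum psumr_eq0; last first.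
  by move=> i _; rewrite linearZ; apply: mulr_ge0 => //; apply/f0/mem_nth.
move=> /allP h; apply: cone_sum => i _.
have := h i (mem_index_enum _); rewrite linearZ /= mulf_eq0.
case/orP=> [/eqP->|fi]; first by rewrite scale0r; exact: cone0.
by apply: coneZ => //; apply: mem_cone; rewrite mem_filter fi mem_nth.
Qed.

Lemma scalar_exists (f : V -> R) : scalar f -> exists g : {scalar V}, g =1 f.
Proof.
move=> lf; pose g : {scalar V} :=
  HB.pack_for {scalar V} f (GRing.isLinear.Build R V R *%R f lf).
by exists g.
Qed.

End Cones.

Section FiniteDimensionalCones.
Variables (R : realFieldType) (V : vectType R).
Implicit Types (s t X : seq V) (x y : V).

Lemma span_cone_subr X x : x \in <<X>>%VS ->
  exists y z, [/\ cone X y, cone X z & x = y - z].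
Proof.
move=> /(@coord_span _ _ _ (in_tuple X)) ->.
pose k i := coord (in_tuple X) i x.
exists (\sum_(i < size X) Num.max (k i) 0 *: X`_i).
exists (\sum_(i < size X) Num.max (- k i) 0 *: X`_i); split.
- apply: cone_sum => i _; apply: coneZ; last exact/mem_cone/mem_nth.
  by rewrite le_max lexx orbT.
- apply: cone_sum => i _; apply: coneZ; last exact/mem_cone/mem_nth.
  by rewrite le_max lexx orbT.
rewrite -sumrB; apply: eq_bigr => i _; rewrite -scalerBl; congr (_ *: _).
rewrite -/(k i); case: (leP (k i) 0) => ki.
  by rewrite max_l ?oppr_ge0 // sub0r opprK.
by rewrite max_r ?subr0 // oppr_le0 ltW.
Qed.

Lemma cone_span X x : cone X x -> x \in <<X>>%VS.
Proof.
move=> [a _ ->]; apply: memv_suml => i _; apply: memvZ.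
exact/memv_span/mem_nth.
Qed.

(** Every subset of a linearly independent set of generators spans a face:
    the sum of the dual coordinates of the other generators cuts it out. *)
Lemma free_cone_face X (P : pred V) : free X ->
  is_face (cone [seq x <- X | P x]) (cone X).
Proof.
move=> fX; have cE (i j : 'I_(size X)) : coord (in_tuple X) j X`_i = (i == j)%:R.
  by rewrite -(coord_free (X := in_tuple X) i j fX).
pose f0 x := \sum_(i < size X | ~~ P X`_i) coord (in_tuple X) i x.
have [f fE] : exists g : {scalar V}, g =1 f0.
  apply: scalar_exists => k x y; rewrite /f0 mulr_sumr -big_split /=.
  by apply: eq_bigr => i _; rewrite linearP.
have fX' i : (i < size X)%N -> f X`_i = (~~ P X`_i)%:R.
  move=> iX; rewrite fE /f0; case: (boolP (P _)) => Pi /=.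
    apply: big1 => j Pj; rewrite (cE (Ordinal iX)).
    by case: eqP Pj => // <- /=; rewrite Pi.
  rewrite (bigD1 (Ordinal iX)) //= (cE (Ordinal iX)) eqxx big1 ?addr0 //.
  by move=> j /andP[_ ji]; rewrite (cE (Ordinal iX)) eq_sym (negPf ji).
have fm x : x \in X -> f x = (~~ P x)%:R.
  by move=> xX; rewrite -(nth_index 0 xX) fX' ?index_mem.
have f_ge0 x : x \in X -> 0 <= f x by move=> /fm ->; exact: ler0n.
exists f => [x|]; first exact: cone_ge0.
rewrite cone_face_filter //; congr cone; apply: eq_in_filter => x /fm ->.
by rewrite pnatr_eq0 eqb0 negbK.
Qed.

End FiniteDimensionalCones.

(** * Adding a linear space to a fan, and quotients of fans *)

Section LinealityFans.
Variables (R : realFieldType) (V : vectType R) (L : {vspace V}).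
Implicit Types (C D : set V) (F : set (set V)).

(** A polyhedral cone that meets each coset of L at most once has a linear span
    that meets L trivially, so some linear map fixes the cone and kills L. *)
Lemma cone_transversal_proj C : polyhedral_cone C ->
    (forall x y, C x -> C y -> x - y \in L -> x = y) ->
  exists2 p : {linear V -> V}, forall x, C x -> p x = x
                             & forall y, y \in L -> p y = 0.
Proof.
move=> [s ->] sL; have dsL : (<<s>> :&: L = 0)%VS.
  apply/eqP; rewrite -subv0; apply/subvP => v; rewrite memv_cap memv0.
  case/andP=> /span_cone_subr[x [y [sx sy ->]]] xyL.
  by rewrite (sL x y sx sy xyL) subrr.
exists (daddv_pi <<s>> L) => [x sx|y yL].
  exact/daddv_pi_id/cone_span.
have yK : daddv_pi L <<s>> y = y by apply: daddv_pi_id => //; rewrite capvC.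
have := daddv_pi_add dsL (subvP (addvSr <<s>> L) y yL).
by rewrite yK => h; apply: (addIr y); rewrite add0r.
Qed.

Lemma scalar_ge0_subspace (f : {scalar V}) :
  (forall y, y \in L -> 0 <= f y) -> forall y, y \in L -> f y = 0.
Proof.
move=> f0 y yL; apply/eqP; rewrite eq_le f0 // andbT.
by rewrite -oppr_ge0 -linearN f0 // rpredN.
Qed.

(** Adding a linear space to all cones of a fan gives a fan as soon as the
    support of the fan meets each coset of L at most once. *)
Lemma is_fan_add F : is_fan F ->
    (forall C D x y, F C -> F D -> C x -> D y -> x - y \in L -> x = y) ->
  is_fan (fan_add F L).
Proof.
move=> [finF [C0 FC0] polF faceF capF] FL.
pose ad C := [set z | exists x y, [/\ C x, y \in L & z = x + y]].
have F0 C : F C -> C 0 by move=> /polF[s ->]; exact: cone0.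
have adL C y : F C -> y \in L -> ad C y.
  by move=> /F0 C0' yL; exists 0, y; rewrite add0r.
have ad_cap C D : F C -> F D -> ad C `&` ad D = ad (C `&` D).
  move=> FC FD; apply/seteqP; split=> z /=; last first.
    by move=> [x [y [[Cx Dx] yL ->]]]; split; exists x, y.
  move=> [[x [y [Cx yL ->]]] [x' [y' [Dx' yL' e]]]]; exists x, y; split=> //.
  split=> //; rewrite (FL C D x x') //.
  by rewrite -(addrK y x) e addrAC (addrC x') addrK rpredB.
have ad_face C D : F C -> is_face D C -> is_face (ad D) (ad C).
  move=> FC [f f0 ->].
  have [//|p pC pL] := cone_transversal_proj (polF _ FC) _.
    by move=> x y; exact: FL.
  have [h hE] : exists h : {scalar V},
      forall x y, C x -> y \in L -> h (x + y) = f x.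
    by exists (f \o p) => x y Cx yL; rewrite /= linearD pC // pL // addr0.
  exists h => [_ [x [y [Cx yL ->]]]|]; first by rewrite hE // f0.
  apply/seteqP; split=> z /=.
    by move=> [x [y [[Cx fx] yL ->]]]; split; [exists x, y|rewrite hE].
  by move=> [[x [y [Cx yL ->]]]]; rewrite hE // => fx; exists x, y.
split.
- exact: finite_image.
- by exists (ad C0), C0.
- move=> _ [C FC <-]; case: (polF _ FC) => s sC.
  pose b : seq V := vbasis L.
  (* As a cone, L is generated by a basis and its negatives. *)
  have bL : <<b>>%VS = L by exact/span_basis/vbasisP.
  exists (s ++ b ++ map -%R b); apply/seteqP; split=> [_ [x [y [Cx yL ->]]]|].
    apply: coneD.
      by move: Cx; rewrite sC; apply: cone_subset => u us; rewrite mem_cat us.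
    move: yL; rewrite -bL => /span_cone_subr[y1 [y2 [b1 b2 ->]]].
    apply: coneD.
      by apply: cone_subset b1 => u ub; rewrite !mem_cat ub orbT.
    case: b2 => a a0 ->; rewrite -sumrN; apply: cone_sum => i _.
    rewrite -scalerN; apply: coneZ => //; apply: mem_cone.
    by rewrite !mem_cat map_f ?orbT // mem_nth.
  rewrite -/(ad C) => _ [a a0 ->]; elim/big_ind: _ => [|u v|i _].
  + by apply: adL => //; exact: mem0v.
  + move=> [x [y [Cx yL ->]]] [x' [y' [Cx' yL' ->]]].
    exists (x + x'), (y + y'); rewrite rpredD // addrACA; split=> //.
    by move: Cx Cx'; rewrite sC; exact: coneD.
  + have := mem_nth 0 (ltn_ord i); set u := _`_i; rewrite !mem_cat.
    have uL : (u \in b) || (u \in map -%R b) -> u \in L.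
      rewrite -bL => /orP[/memv_span//|/mapP[v vb ->]].
      by rewrite rpredN memv_span.
    case/orP=> [us|/uL uL']; last by apply: adL => //; exact: memvZ.
    exists (a i *: u), 0; rewrite mem0v addr0; split=> //.
    by rewrite sC; apply: coneZ => //; exact: mem_cone.
- move=> _ D [C FC <-] [f f0 ->]; rewrite -/(ad C) in f0 *.
  have fL y : y \in L -> f y = 0.
    by apply: scalar_ge0_subspace => u uL; apply/f0/adL.
  exists (C `&` [set x | f x = 0]).
    apply: (faceF C) => //; exists f => // x Cx; apply: f0.
    by exists x, 0; rewrite mem0v addr0.
  rewrite -/(ad _); apply/seteqP; split=> z /=.
    move=> [x [y [[Cx fx] yL ->]]]; split; first by exists x, y.
    by rewrite linearD fx fL // addr0.
  move=> [[x [y [Cx yL ->]]]]; rewrite linearD (fL y) // addr0 => fx.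
  by exists x, y.
- move=> _ _ [C FC <-] [D FD <-]; rewrite -/(ad C) -/(ad D) ad_cap //.
  by have [fC fD] := capF C D FC FD; split; exact: ad_face.
Qed.

(** A fan all of whose cones are stable under translation by L passes to the
    quotient by L. *)
Lemma is_fan_quot F : is_fan F ->
    (forall C x y, F C -> C x -> y \in L -> C (x + y)) ->
  is_fan (fan_quot F L).
Proof.
move=> [finF [C0 FC0] polF faceF capF] FL.
pose q C := [set vquot_proj L x | x in C].
have F0 C : F C -> C 0 by move=> /polF[s ->]; exact: cone0.
have qP C x : F C -> q C (vquot_proj L x) <-> C x.
  move=> FC; split=> [[y Cy /esym/vquot_projP xyL]|Cx]; last by exists x.
  by rewrite -(subrK y x) addrC; exact: FL.
have q_face C D : F C -> is_face D C -> is_face (q D) (q C).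
  move=> FC [f f0 ->].
  have fL y : y \in L -> f y = 0.
    apply: scalar_ge0_subspace => u uL; apply: f0.
    by rewrite -(add0r u); apply: (FL C) => //; exact: F0.
  (* The functional vanishes on L, so its value at any representative is the
     value of a functional on the quotient. *)
  pose g0 (z : vquot L) := f (repr (z : Quotient.quot (pred_of_vspace L))).
  have g0E x : g0 (vquot_proj L x) = f x.
    apply/eqP; rewrite -subr_eq0 -linearB; apply/eqP/fL/vquot_projP.
    exact: vquot_proj_repr.
  have [g gE] : exists g : {scalar vquot L}, g =1 g0.
    apply: scalar_exists => k x y.
    rewrite -(vquot_proj_repr x) -(vquot_proj_repr y).
    by rewrite -linearP !g0E linearP.
  exists g => [_ [x Cx <-]|]; first by rewrite gE g0E f0.
  apply/seteqP; split=> [_ [x [Cx fx] <-]|_ [[x Cx <-]]] /=.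
    by split; [exists x|rewrite gE g0E].
  by rewrite gE g0E => fx; exists x.
split.
- exact: finite_image.
- by exists (q C0), C0.
- move=> _ [C FC <-]; case: (polF _ FC) => s ->.
  exists (map (vquot_proj L) s); apply/seteqP; split=> z.
    move=> [_ [a a0 ->] <-]; rewrite linear_sum; apply: cone_sum => i _.
    by rewrite linearZ; apply: coneZ => //; exact/mem_cone/map_f/mem_nth.
  move=> [a a0 ->]; rewrite size_map; exists (\sum_(i < size s) a i *: s`_i).
    by exists a.
  rewrite linear_sum; apply: eq_bigr => i _.
  by rewrite linearZ (nth_map 0).
- move=> _ D [C FC <-] [f f0 ->]; rewrite -/(q C) in f0 *.
  exists (C `&` [set x | (f \o vquot_proj L) x = 0]).
    apply: (faceF C) => //; exists (f \o vquot_proj L) => // x Cx.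
    by apply: f0; exists x.
  apply/seteqP; split=> [_ [x [Cx fx] <-]|_ [[x Cx <-]] fx].
    by split=> //; exists x.
  by exists x.
- move=> _ _ [C FC <-] [D FD <-]; rewrite -/(q C) -/(q D).
  have -> : q C `&` q D = q (C `&` D).
    apply/seteqP; split=> [_ [[x Cx <-]] /(qP D x FD) Dx|_ [x [Cx Dx] <-]].
      by exists x.
    by split; exists x.
  by have [fC fD] := capF C D FC FD; split; exact: q_face.
Qed.

End LinealityFans.

(** * Fans of chains of sets *)

Section ChainFans.
Variables (R : realType) (E : finType).
Implicit Types (T U : {set E}) (c d : seq {set E}) (v w : {ffun E -> R^o}).

Local Notation chain := (sorted (fun T U : {set E} => T \proper U)).
Local Notation evec := (@evec R E).

Lemma proper_transitive : transitive (fun T U : {set E} => T \proper U).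
Proof. by move=> ? ? ?; exact: fintype.proper_trans. Qed.

Lemma chain_uniq c : chain c -> uniq c.
Proof. by apply: (sorted_uniq proper_transitive) => T; rewrite fintype.properxx. Qed.

Lemma chain_comparable c T U : chain c -> T \in c -> U \in c ->
  (T \subset U) || (U \subset T).
Proof.
elim: c => // S c IH /=; rewrite (path_sortedE proper_transitive).
case/andP=> /allP Sc cc; rewrite !inE.
case/predU1P=> [->|Tc] /predU1P[->|Uc].
- by rewrite subxx.
- by rewrite proper_sub ?Sc.
- by rewrite orbC proper_sub ?Sc.
- exact: IH.
Qed.

Lemma evecE T t : evec T t = (t \in T)%:R.
Proof.
rewrite /Defs.evec sum_ffunE; case: (boolP (t \in T)) => tT.
  rewrite (bigD1 t) //= ffunE eqxx big1 ?addr0 // => s /andP[_ st].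
  by rewrite ffunE eq_sym (negPf st).
apply: big1 => s sT; rewrite ffunE; case: eqP => // ts.
by rewrite ts sT in tT.
Qed.

Lemma sum_evecE c (a : {set E} -> R) t :
  (\sum_(T <- c) a T *: evec T) t = \sum_(T <- c) a T * (t \in T)%:R.
Proof. by rewrite sum_ffunE; apply: eq_bigr => T _; rewrite ffunE evecE. Qed.

(** The nonempty sets on which v is positive and larger than outside, that is,
    the superlevel sets of v at positive levels. *)
Definition superlevel v T : Prop :=
  T != finset.set0 /\
  forall s, s \in T -> 0 < v s /\ forall t, t \notin T -> v t < v s.

Lemma chain_sum_lt c (a : {set E} -> R) T s t : chain c -> (forall U, 0 <= a U) ->
    T \in c -> 0 < a T -> s \in T -> t \notin T ->
  \sum_(U <- c) a U * (t \in U)%:R < \sum_(U <- c) a U * (s \in U)%:R.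
Proof.
move=> cc a0 Tc aT sT tT.
rewrite !(bigD1_seq T) ?chain_uniq //= sT (negPf tT) mulr0 mulr1.
apply: ltr_leD => //; rewrite big_seq_cond [leRHS]big_seq_cond.
apply: ler_sum => U /andP[Uc _]; apply: ler_wpM2l => //.
rewrite ler_nat; case: (boolP (t \in U)) => // tU.
case/orP: (chain_comparable cc Tc Uc) => [/fintype.subsetP/(_ s sT) ->//|].
by move=> /fintype.subsetP/(_ t tU); rewrite (negPf tT).
Qed.

(** The sets that carry a positive coefficient in a nonnegative combination of
    a chain are superlevel sets of the combination. *)
Lemma chain_superlevel c (a : {set E} -> R) T : chain c -> (forall U, 0 <= a U) ->
    T \in c -> T != finset.set0 -> 0 < a T ->
  superlevel (\sum_(U <- c) a U *: evec U) T.
Proof.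
move=> cc a0 Tc T0 aT; split=> // s sT; rewrite !sum_evecE; split.
  rewrite (bigD1_seq T) ?chain_uniq //= sT mulr1 ltr_wpDr //.
  by apply: sumr_ge0 => U _; apply: mulr_ge0; rewrite ?ler0n.
by move=> t tT; rewrite sum_evecE; exact: chain_sum_lt Tc aT sT tT.
Qed.

(** Every superlevel set of a nonnegative combination of a chain is a member of
    the chain and carries a positive coefficient. *)
Lemma superlevel_chain c (a : {set E} -> R) T : chain c -> (forall U, 0 <= a U) ->
    superlevel (\sum_(U <- c) a U *: evec U) T ->
  T \in c /\ 0 < a T.
Proof.
move=> cc a0; set v := \sum_(U <- c) _ => -[/finset.set0Pn[s0 s0T] slT].
have vE t : v t = \sum_(U <- c) a U * (t \in U)%:R by exact: sum_evecE.
pose s := [arg min_(s < s0 in T) v s]%O.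
have [sT smin] : s \in T /\ forall t, t \in T -> v s <= v t.
  by rewrite /s; case: arg_minP.
have [vs0 sgt] := slT s sT.
(* The claim is that T is the smallest member of the chain with a positive
   coefficient that contains a minimum point s of v on T. *)
pose Q U := [&& U \in c, s \in U & 0 < a U].
have /hasP[U0 U0c /andP[sU0 aU0]] : has (fun U => (s \in U) && (0 < a U)) c.
  apply/negPn/negP => /hasPn nU; move: vs0; rewrite vE big_seq big1 ?ltxx //.
  move=> U Uc; have := nU U Uc; case: (s \in U) => /=; last by rewrite mulr0.
  by rewrite lt_def a0 andbT negbK => /eqP->; rewrite mul0r.
have QU0 : Q U0 by rewrite /Q U0c sU0.
case: (arg_minnP (fun U => #|U|) QU0) => U /and3P[Uc sU aU] Umin.
suff -> : T = U by [].
apply/finset.setP => t; apply/idP/idP => [tT|tU]; apply/negPn/negP.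
  move=> tU; have := chain_sum_lt cc a0 Uc aU sU tU.
  by rewrite -!vE ltNge smin.
move=> tT; have := sgt t tT; rewrite ltNge => /negP; apply.
rewrite !vE big_seq [leRHS]big_seq; apply: ler_sum => W Wc.
have [->|aW] := eqVneq (a W) 0; first by rewrite !mul0r.
have {}aW : 0 < a W by rewrite lt_def aW a0.
apply: ler_wpM2l => //; rewrite ler_nat; case: (boolP (s \in W)) => // sW.
have leUW : (#|U| <= #|W|)%N by apply: Umin; rewrite /Q Wc sW aW.
case/orP: (chain_comparable cc Uc Wc) => [/fintype.subsetP/(_ t tU) ->//|WU].
have /eqP -> : W == U by rewrite eqEcard WU.
by rewrite tU.
Qed.

(** A strictly increasing sequence of nonempty sets. *)
Definition nonempty_chain c := chain c && all (fun T => T != finset.set0) c.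

Lemma nonempty_chainP c : nonempty_chain c ->
  [/\ chain c, uniq c & forall T, T \in c -> T != finset.set0].
Proof. by case/andP=> cc /allP; split=> //; exact: chain_uniq. Qed.

(** Splitting a linear relation among the generators into its positive and
    negative parts yields two nonnegative combinations with the same value and
    disjoint supports, so both parts vanish. *)
Lemma chain_free c : nonempty_chain c -> free [seq evec T | T <- c].
Proof.
move=> /nonempty_chainP[cc uc c0]; apply/(@freeP _ _ _ (in_tuple _)) => k.
set X := [seq _ | _ <- _] => k0 i.
have sX : size X = size c by rewrite size_map.
pose a T : R := if insub (index T c) is Some j then k j else 0.
have kE (j : 'I_(size X)) : k j = a (nth finset.set0 c j).
  by rewrite /a index_uniq -?sX // valK.
have : \sum_(T <- c) a T *: evec T = 0.
  rewrite (big_nth finset.set0) big_mkord -[RHS]k0 -sX.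
  apply: eq_bigr => j _; rewrite kE; congr (_ *: _).
  by rewrite /= (nth_map finset.set0) // -sX.
pose p T := Num.max (a T) 0; pose m T := Num.max (- a T) 0.
have p0 T : 0 <= p T by rewrite le_max lexx orbT.
have m0 T : 0 <= m T by rewrite le_max lexx orbT.
have aE T : a T = p T - m T.
  rewrite /p /m; case: (leP (a T) 0) => aT.
    by rewrite max_l ?oppr_ge0 // sub0r opprK.
  by rewrite max_r ?subr0 // oppr_le0 ltW.
under eq_bigr do rewrite aE scalerBl.
rewrite sumrB => /eqP; rewrite subr_eq0 => /eqP pm.
have [//|] := eqVneq (k i) 0; rewrite kE; set T := nth _ _ _ => aT.
have Tc : T \in c by rewrite mem_nth // -sX.
(* Both combinations define the same vector, so T, which carries a positive
   coefficient in one of them, carries one in the other. *)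
have : 0 < p T /\ 0 < m T.
  move: aT; rewrite neq_lt => /orP[aT|aT].
    have mT : 0 < m T by rewrite lt_max oppr_gt0 aT.
    split=> //; apply: (superlevel_chain cc p0 _).2; rewrite pm.
    by apply: chain_superlevel => //; exact: c0.
  have pT : 0 < p T by rewrite lt_max aT.
  split=> //; apply: (superlevel_chain cc m0 _).2; rewrite -pm.
  by apply: chain_superlevel => //; exact: c0.
rewrite /p /m !lt_max !ltxx !orbF oppr_gt0 => -[aT1 aT2].
by have := lt_trans aT1 aT2; rewrite ltxx.
Qed.

Lemma chain_cone_cap c d : nonempty_chain c -> nonempty_chain d ->
  cone [seq evec T | T <- c] `&` cone [seq evec T | T <- d] =
  cone [seq evec T | T <- c & T \in d].
Proof.
move=> /nonempty_chainP[cc uc c0] /nonempty_chainP[cd ud d0].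
apply/seteqP; split=> v /=; last first.
  by move=> cv; split; apply: cone_subset cv => _ /mapP[T + ->];
    rewrite mem_filter => /andP[Td Tc]; exact: map_f.
case=> /cone_mapP-/(_ uc)[a a0 ->] /cone_mapP-/(_ ud)[b b0 vb].
rewrite big_seq; apply: cone_sum => T Tc.
have [->|aT] := eqVneq (a T) 0; first by rewrite scale0r; exact: cone0.
have {}aT : 0 < a T by rewrite lt_def aT a0.
apply: coneZ => //; apply/mem_cone/map_f; rewrite mem_filter Tc andbT.
apply: (superlevel_chain cd b0 _).1; rewrite -vb.
by apply: chain_superlevel => //; exact: c0.
Qed.

Lemma chain_cone_ge0 c v t : cone [seq evec T | T <- c] v -> 0 <= v t.
Proof.
case=> a a0 ->; rewrite sum_ffunE size_map; apply: sumr_ge0 => i _.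
rewrite ffunE; apply: mulr_ge0 => //.
by rewrite (nth_map finset.set0) // evecE ler0n.
Qed.

(** The cones spanned by the chains of nonempty sets that satisfy P. *)
Definition chain_fan (P : pred {set E}) : set (set {ffun E -> R^o}) :=
  [set C | exists c,
     [/\ chain c, all (fun T => (T != finset.set0) && P T) c
       & C = cone [seq evec T | T <- c]]].

Lemma chain_fanP P C : chain_fan P C <->
  exists c, [/\ nonempty_chain c, all P c & C = cone [seq evec T | T <- c]].
Proof.
split=> -[c []].
  by rewrite all_predI => cc /andP[c0 Pc] ->; exists c; rewrite /nonempty_chain cc.
by case/andP=> cc c0 Pc ->; exists c; rewrite all_predI c0.
Qed.

Lemma nonempty_chain_filter c (Q : pred {set E}) :
  nonempty_chain c -> nonempty_chain (filter Q c).
Proof.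
case/andP=> cc c0; apply/andP; split.
  exact: sorted_filter proper_transitive _ _ cc.
by apply/allP => T; rewrite mem_filter => /andP[_ /(allP c0)].
Qed.

Lemma chain_subcone_face c (Q : pred {set E}) : nonempty_chain c ->
  is_face (cone [seq evec T | T <- c & Q T]) (cone [seq evec T | T <- c]).
Proof.
move=> cc; have := free_cone_face
  (fun v => v \in [seq evec T | T <- c & Q T]) (chain_free cc).
congr is_face; apply: eq_mem_cone => v; rewrite mem_filter andb_idr //.
by move=> /mapP[T + ->]; rewrite mem_filter => /andP[_ /map_f ->].
Qed.

Lemma chain_fan_is_fan P : is_fan (chain_fan P).
Proof.
split.
- apply: (@sub_finite_set _ _
    [set cone [seq evec T | T <- enum A] | A in [set: {set {set E}}]]).
    move=> _ [c [_ _ ->]]; exists [set T in c]%SET => //; apply: eq_mem_cone => v.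
    by apply/mapP/mapP => -[T Tc ->]; exists T => //; move: Tc;
      rewrite mem_enum inE.
  exact/finite_image/finite_finset.
- by exists (cone [::]), [::].
- by move=> _ [c [_ _ ->]]; eexists.
- move=> _ D /chain_fanP[c [cc Pc ->]] [f f0 ->]; apply/chain_fanP.
  exists [seq T <- c | f (evec T) == 0]; split.
  + exact: nonempty_chain_filter.
  + by apply/allP => T; rewrite mem_filter => /andP[_ /(allP Pc)].
  + rewrite cone_face_filter ?filter_map // => y yc.
    exact/f0/mem_cone.
- move=> _ _ /chain_fanP[c [cc _ ->]] /chain_fanP[d [cd _ ->]]; split.
    by rewrite chain_cone_cap //; exact: chain_subcone_face.
  by rewrite setIC chain_cone_cap //; exact: chain_subcone_face.
Qed.

Lemma chain_fan_pointed P : pointed_fan (chain_fan P).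
Proof.
split=> [|_ v [c [_ _ ->]] cv cNv]; first exact: chain_fan_is_fan.
apply/ffunP => t; rewrite ffunE; apply/eqP.
rewrite eq_le (chain_cone_ge0 t cv) andbT.
by have := chain_cone_ge0 t cNv; rewrite ffunE oppr_ge0.
Qed.

End ChainFans.

Arguments chain_fan R {E} P.

(** * Sets containing no fiber, valid tuples, and the lineality space *)

Section FiberTuples.
Variables (R : realType) (E : finType) (n : nat) (pi : E -> 'I_n).
Implicit Types (T U : {set E}) (A B : {ffun 'I_n -> {set E}}).

(** The sets that contain no fiber of pi. *)
Definition fiber_free T : bool := [forall i, ~~ (fiber pi i \subset T)].

(** The complement of the union of a tuple: the set whose indicator vector is the
    generator indexed by the tuple. *)
Definition tuple_compl A : {set E} := (~: \bigcup_i A i)%SET.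

(** The tuple of the complements of a set in the fibers; on sets containing no
    fiber it is inverse to [tuple_compl] restricted to valid tuples. *)
Definition fiber_compl T : {ffun 'I_n -> {set E}} :=
  [ffun i => fiber pi i :\: T]%SET.

Lemma in_fiber s i : (s \in fiber pi i) = (pi s == i).
Proof. by rewrite inE. Qed.

Lemma in_tuple_compl A s : valid pi A -> (s \in tuple_compl A) = (s \notin A (pi s)).
Proof.
move=> /forallP vA; rewrite finset.in_setC; congr negb; apply/bigcupP/idP.
  case=> i _ si; have /andP[_ /fintype.subsetP/(_ s si)] := vA i.
  by rewrite in_fiber => /eqP->.
by exists (pi s).
Qed.

Lemma tuple_complK A : valid pi A -> fiber_compl (tuple_compl A) = A.
Proof.
move=> vA; apply/ffunP => i; apply/finset.setP => s.
rewrite ffunE !inE -finset.in_setC -/(tuple_compl A) in_tuple_compl // negbK.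
apply/andP/idP => [[sA /eqP <-]//|sA].
have /forallP/(_ i)/andP[_ /fintype.subsetP/(_ s sA)] := vA.
by rewrite in_fiber => /eqP e; rewrite e eqxx.
Qed.

Lemma fiber_compl_valid T : fiber_free T -> valid pi (fiber_compl T).
Proof.
move=> /forallP fT; apply/forallP => i; rewrite ffunE finset.subsetDl andbT.
by rewrite finset.setD_eq0.
Qed.

Lemma fiber_complK T : fiber_free T -> tuple_compl (fiber_compl T) = T.
Proof.
move=> fT; apply/finset.setP => s.
rewrite in_tuple_compl ?fiber_compl_valid // ffunE !inE eqxx andbT.
exact: negbK.
Qed.

Lemma tuple_compl_fiber_free A : valid pi A -> fiber_free (tuple_compl A).
Proof.
move=> vA; apply/forallP => i; have /forallP/(_ i)/andP[] := vA.
rewrite -finset.setD_eq0 -{1}(tuple_complK vA) ffunE.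
by rewrite finset.setD_eq0.
Qed.

Lemma fiber_compl0 : fiber_compl finset.set0 = Etuple pi.
Proof. by apply/ffunP => i; rewrite !ffunE finset.setD0. Qed.

Lemma tuple_compl_proper : {in valid pi &,
  forall A B, tuple_proper A B -> tuple_compl B \proper tuple_compl A}.
Proof.
move=> A B vA vB /andP[/forallP AB nAB]; rewrite finset.properEneq.
apply/andP; split.
  apply: contra nAB => /eqP BA.
  by rewrite -(tuple_complK vA) -(tuple_complK vB) BA.
apply/fintype.subsetP => s; rewrite !in_tuple_compl //.
exact/contra/fintype.subsetP/AB.
Qed.

Lemma fiber_compl_proper : {in fiber_free &,
  forall T U, T \proper U -> tuple_proper (fiber_compl U) (fiber_compl T)}.
Proof.
move=> T U fT fU TU; apply/andP; split.
  by apply/forallP => i; rewrite !ffunE finset.setDS // fintype.proper_sub.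
apply: contraTneq TU => e.
by rewrite -(fiber_complK fT) -(fiber_complK fU) e fintype.properxx.
Qed.

(** The fan of valid tuples is the fan of chains of nonempty sets containing no
    fiber. Taking complements reverses inclusions, hence the list reversals. *)
Lemma hat_PsiE : hat_Psi R pi = chain_fan R fiber_free.
Proof.
apply/seteqP; split=> C [c [cc /allP Pc ->]].
  have vc : all (valid pi) c by apply/allP => A /Pc/andP[].
  exists (rev [seq tuple_compl A | A <- c]); split.
  - rewrite rev_sorted.
    exact: (homo_sorted_in tuple_compl_proper vc cc).
  - apply/allP => T; rewrite mem_rev => /mapP[A Ac ->].
    have /andP[vA AE] := Pc A Ac; rewrite tuple_compl_fiber_free // andbT.
    apply: contra AE => /eqP A0.
    by rewrite -(tuple_complK vA) A0 fiber_compl0.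
  - apply: eq_mem_cone => v; rewrite map_rev mem_rev -map_comp.
    by congr (v \in _); apply: eq_map.
have fc : all fiber_free c by apply/allP => T /Pc/andP[].
exists (rev [seq fiber_compl T | T <- c]); split.
- rewrite rev_sorted.
  exact: (homo_sorted_in fiber_compl_proper fc cc).
- apply/allP => A; rewrite mem_rev => /mapP[T Tc ->].
  have /andP[T0 fT] := Pc T Tc; rewrite fiber_compl_valid //=.
  apply: contra T0 => /eqP/ffunP TE; apply/eqP/finset.setP => s.
  have /finset.setP/(_ s) := TE (pi s).
  by rewrite !ffunE !inE eqxx andbT => /negbTE.
- apply: eq_mem_cone => v; rewrite map_rev mem_rev -map_comp.
  congr (v \in _); apply/eq_in_map => T /(allP fc) fT /=.
  by rewrite /uvec -/(tuple_compl _) fiber_complK.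
Qed.

Lemma colored_fiber_free T : (forall i, (2 <= #|fiber pi i|)%N) ->
  colored pi T -> fiber_free T.
Proof.
move=> f2 /forallP cT; apply/forallP => i; apply/negP => iT.
have := cT i; rewrite (finset.setIidPr iT) => /(leq_trans (f2 i)).
by rewrite ltnn.
Qed.

Lemma chain_fan_sub (P Q : pred {set E}) : subpred P Q ->
  chain_fan R P `<=` chain_fan R Q.
Proof.
move=> PQ C [c [cc Pc ->]]; exists c; split=> //.
by apply: sub_all Pc => T /andP[-> /PQ].
Qed.

Lemma lineality_fiber y s t : y \in lineality R pi -> pi s = pi t -> y s = y t.
Proof.
move=> /span_cone_subr[_ [_ [[a _ ->] [b _ ->] ->]]] st.
suff sum_eq m (k : nat -> R) :
    let X := [seq evec R (fiber pi i) | i : 'I_n] in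
    (\sum_(i < m) k i *: X`_i) s = (\sum_(i < m) k i *: X`_i) t.
  have subE (v w : {ffun E -> R^o}) r : (v - w) r = v r - w r.
    by rewrite !ffunE.
  by rewrite !subE !sum_eq.
move=> X; rewrite !sum_ffunE; apply: eq_bigr => i _; rewrite !ffunE.
congr (_ * _); case: (ltnP i (size X)) => iX; last first.
  by rewrite nth_default // !ffunE.
have /mapP[j _ ->] := mem_nth 0 iX.
by rewrite !evecE !in_fiber st.
Qed.

(** The largest member of the chain misses a point of the fiber. *)
Lemma chain_cone_fiber_zero c x i : (0 < #|fiber pi i|)%N ->
    nonempty_chain c -> all fiber_free c -> cone [seq evec R T | T <- c] x ->
  exists2 s, pi s = i & x s = 0.
Proof.
move=> i0 /nonempty_chainP[cc uc _] /allP fc /cone_mapP-/(_ uc)[a _ ->].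
have [s si sc] : exists2 s, pi s = i & forall T, T \in c -> s \notin T.
  have [[T0 T0c]|c0] := pselect (exists T, T \in c); last first.
    have /card_gt0P[s] := i0; rewrite in_fiber => /eqP si; exists s => // T Tc.
    by case: c0; exists T.
  case: (@arg_maxnP _ T0 (mem c) (fun T => #|T|) T0c) => T Tc Tmax.
  have /forallP/(_ i)/fintype.subsetPn[s] := fc T Tc.
  rewrite in_fiber => /eqP si sT; exists s => // U Uc.
  apply: contra sT; case/orP: (chain_comparable cc Uc Tc) => [/fintype.subsetP|TU].
    exact.
  have /eqP <- // : T == U by rewrite eqEcard TU; exact: Tmax.
exists s => //; rewrite sum_evecE big_seq big1 // => T /sc /negPf->.
by rewrite mulr0.
Qed.

(** Vectors in the support of the fan have minimum 0 on every fiber, while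
    vectors of the lineality space are constant on fibers. *)
Lemma chain_fan_lineality C D x y : (forall i, (0 < #|fiber pi i|)%N) ->
    chain_fan R fiber_free C -> chain_fan R fiber_free D ->
    C x -> D y -> x - y \in lineality R pi -> x = y.
Proof.
move=> i0 /chain_fanP[c [cc fc ->]] /chain_fanP[d [cd fd ->]] cx dy xy.
apply/ffunP => s; have xyE t : pi t = pi s -> x s - y s = x t - y t.
  by move=> ts; have := lineality_fiber xy ts; rewrite !ffunE.
have [t ts xt] := chain_cone_fiber_zero (i0 (pi s)) cc fc cx.
have [u us yu] := chain_cone_fiber_zero (i0 (pi s)) cd fd dy.
apply/eqP; rewrite -subr_eq0 eq_le; apply/andP; split.
  by rewrite (xyE t ts) xt sub0r oppr_le0; exact: chain_cone_ge0 dy.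
by rewrite (xyE u us) yu subr0; exact: chain_cone_ge0 cx.
Qed.

End FiberTuples.

Lemma fan_add_translate (R : numFieldType) (V : vectType R) (L : {vspace V})
    (F : set (set V)) C x y :
  fan_add F L C -> C x -> y \in L -> C (x + y).
Proof.
move=> [D _ <-] [z [w [Dz wL ->]]] yL.
by exists z, (w + y); rewrite rpredD // addrA.
Qed.

Theorem proposition8p7 (R : realType) (E : finType) (n : nat) (pi : E -> 'I_n)
    (pi_surj : forall i : 'I_n, exists s : E, pi s = i)
    (fiber_ge2 : forall i : 'I_n, (2 <= #|fiber pi i|)%N) :
  [/\ pointed_fan (hat_Sigma R pi) /\ subfan (hat_Sigma R pi) (hat_Psi R pi),
      subfan (tilde_Sigma R pi) (Psi R pi)
    & subfan (Sigma R pi) (Psi_quot R pi)].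
Proof.
have fiber_gt0 i : (0 < #|fiber pi i|)%N by exact: ltnW.
have pointedS : pointed_fan (hat_Sigma R pi) by exact: chain_fan_pointed.
have fanS : is_fan (hat_Sigma R pi) by case: pointedS.
have fanP : is_fan (hat_Psi R pi) by rewrite hat_PsiE; exact: chain_fan_is_fan.
have SP : hat_Sigma R pi `<=` hat_Psi R pi.
  by rewrite hat_PsiE; apply: chain_fan_sub => T; exact: colored_fiber_free.
have PL C D x y : hat_Psi R pi C -> hat_Psi R pi D -> C x -> D y ->
    x - y \in lineality R pi -> x = y.
  by rewrite hat_PsiE; exact: chain_fan_lineality.
have fanSL : is_fan (tilde_Sigma R pi).
  by apply: is_fan_add => // C D x y /SP CP /SP DP; exact: PL.
have fanPL : is_fan (Psi R pi) by exact: is_fan_add.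
have SPL : tilde_Sigma R pi `<=` Psi R pi by exact: image_subset.
split; [by []|by []|split].
- by apply: is_fan_quot => // C x y; exact: fan_add_translate.
- by apply: is_fan_quot => // C x y; exact: fan_add_translate.
- exact: image_subset.
Qed.
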